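(* For $i=2,3,\dots$, the following statements hold: (1) $e_{i+1}e_iT_ie_{i+1}=e_{i+1}T_ie_ie_{i+1}$; (2) $e_ie_{i-1}T_ie_i=e_iT_ie_{i-1}e_i$; (3) $z_i^*=z_i$ and $T_i^*=T_i$; (4) $e_{i-1}T_{i+1}=T_{i+1}e_{i-1}$; (5) $e_i(xT_i+T_{i+1})=(xT_i+T_{i+1})e_i$; (6) $T_i$ commutes with $\mathcal{A}_{i-1}(x)$; (7) the element $z_i=\sum_{k=0}^i x^kT_{i-k}$ is central in $\mathcal{A}_i(x)$.
   Context: Let $x$ be an indeterminate and $R=\mathbb{Z}[x]$. The Temperley–Lieb algebra $\mathcal{A}_n(x)$ is the unital associative $R$-algebra generated by $e_1,\dots,e_{n-1}$ subject to $e_i^2=xe_i$; $e_ie_{i\pm1}e_i=e_i$ (whenever both indices lie in $\{1,\dots,n-1\}$); $e_ie_j=e_je_i$ for $|i-j|\ge2$. By convention $\mathcal{A}_1(x)=R$, and $\mathcal{A}_i(x)$ is regarded as the subalgebra of $\mathcal{A}_{i+1}(x)$ generated by $e_1,\dots,e_{i-1}$, giving a tower $\mathcal{A}_1(x)\subseteq\mathcal{A}_2(x)\subseteq\cdots$; each identity is read in $\mathcal{A}_n(x)$ for any $n$ large enough that all elements occurring in it are defined. The map $*$ is the $R$-linear algebra anti-involution with $e_i^*=e_i$ for all $i$. The elements $T_i$ and $z_i$ of $\mathcal{A}_i(x)$ are defined by $T_0=0$, $T_1=0$, $T_2=e_1$, and $$T_{i+1}=-e_iT_i-T_ie_i+e_ie_{i-1}T_ie_i-z_{i-1}-e_iz_{i-2}\qquad(i=2,3,\dots),$$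 where $z_0=0$, $z_1=0$ and $z_i=\sum_{k=0}^ix^kT_{i-k}$ for $i=2,3,\dots$. *)

(* Defs.v *)
From HB Require Import structures.
From mathcomp Require Import all_boot all_order all_algebra.
From mathcomp Require Import generic_quotient ring_quotient.
From mathcomp Require Import boolp finmap monalg.

Set Implicit Arguments.
Unset Strict Implicit.
Unset Printing Implicit Defensive.

Import GRing.Theory.
Local Open Scope ring_scope.
Local Open Scope quotient_scope.

Inductive ideal_gen (A : nzRingType) (S : A -> Prop) : A -> Prop :=
| IdealGen a : S a -> ideal_gen S a
| Ideal0 : ideal_gen S 0
| IdealB a b : ideal_gen S a -> ideal_gen S b -> ideal_gen S (a - b)
| IdealMl a b : ideal_gen S b -> ideal_gen S (a * b)
| IdealMr a b : ideal_gen S a -> ideal_gen S (a * b).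

Inductive subalg_gen (R : nzRingType) (A : algType R) (S : A -> Prop) :
  A -> Prop :=
| SubalgGen a : S a -> subalg_gen S a
| Subalg1 : subalg_gen S 1
| SubalgD a b : subalg_gen S a -> subalg_gen S b -> subalg_gen S (a + b)
| SubalgZ c a : subalg_gen S a -> subalg_gen S (c *: a)
| SubalgM a b : subalg_gen S a -> subalg_gen S b -> subalg_gen S (a * b).

Definition commutes_with (A : nzRingType) (S : A -> Prop) (z : A) :=
  forall a, S a -> z * a = a * z.

Definition central_in (A : nzRingType) (S : A -> Prop) (z : A) :=
  S z /\ commutes_with S z.

Definition TLidx (n : nat) := {i : nat | (0 < i < n)%N}.

Notation TLfree n := {malg {poly int}[{fmonom (TLidx n)}]}.

HB.lock Definition TLvar n (i : TLidx n) : TLfree n := << fmu i >>.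

Inductive TLrel n : TLfree n -> Prop :=
| TLrel_sq i : TLrel (TLvar i * TLvar i - 'X *: TLvar i)
| TLrel_adj i j : val j = (val i).+1 \/ val i = (val j).+1 ->
    TLrel (TLvar i * TLvar j * TLvar i - TLvar i)
| TLrel_far i j : ((val i).+2 <= val j)%N \/ ((val j).+2 <= val i)%N ->
    TLrel (TLvar i * TLvar j - TLvar j * TLvar i).

Definition TLideal n (a : TLfree n) : bool := `[< ideal_gen (@TLrel n) a >].
Arguments TLideal : clear implicits.

Lemma TLidealP n (a : TLfree n) :
  reflect (ideal_gen (@TLrel n) a) (a \in TLideal n).
Proof. exact: asboolP. Qed.

Lemma TLideal_zmod_closed n : zmod_closed (TLideal n).
Proof.
split; first by apply/TLidealP; exact: Ideal0.
by move=> a b /TLidealP Ia /TLidealP Ib; apply/TLidealP; exact: IdealB.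
Qed.

HB.instance Definition _ n :=
  GRing.isZmodClosed.Build (TLfree n) (TLideal n) (@TLideal_zmod_closed n).

Definition TL (n : nat) :=
  Quotient.quot (GRing.ZmodClosed.clone (TLfree n) (TLideal n) _).
HB.instance Definition _ n := GRing.Zmodule.on (TL n).
HB.instance Definition _ n := EqQuotient.on (TL n).

(* The operations are sealed with [HB.lock]: otherwise unification unfolds
   the products of the free algebra, at great cost. *)
HB.lock Definition TLpi n (a : TLfree n) : TL n := \pi a.

HB.lock Definition TLmul n (x y : TL n) : TL n := TLpi (repr x * repr y).

HB.lock Definition TLscale n (c : {poly int}) (x : TL n) : TL n :=
  TLpi (c *: repr x).

Definition TLone n : TL n := TLpi 1.

Lemma rmorph_comm0 (A : nzRingType) (S : comNzRingType)
  (f : {rmorphism A -> S}) a b : f (a * b - b * a) = 0.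
Proof. by rewrite rmorphB !rmorphM mulrC subrr. Qed.

Section FreeFacts.
Variables (R : comNzRingType) (K : monomType).
Implicit Types (a b : {malg R[K]}).

Lemma malg_ind (P : {malg R[K]} -> Prop) :
  P 0 -> (forall a b, P a -> P b -> P (a + b)) ->
  (forall c k, P << c *g k >>) -> forall a, P a.
Proof.
move=> P0 PD PU a; rewrite [a]monalgE.
by elim/big_ind: _ => // k _; exact: PU.
Qed.

Lemma malgUM c d (k l : K) :
  << c *g k >> * << d *g l >> = << c * d *g mmul k l >> :> {malg R[K]}.
Proof. by rewrite malgM_def fgmulUU. Qed.

Lemma malgC_comm c a : a * c%:MP = c%:MP * a.
Proof.
elim/malg_ind: a => [|a b Ha Hb|d k]; first by rewrite mulr0 mul0r.
  by rewrite mulrDl mulrDr Ha Hb.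
by rewrite !malgUM mulm1 mul1m mulrC.
Qed.

Lemma malg_scalerAr c a b : c *: (a * b) = a * (c *: b).
Proof. by rewrite -!mul_malgC !mulrA malgC_comm. Qed.
End FreeFacts.

Section Structure.
Variable n : nat.
Local Notation F := (TLfree n).
Local Notation I := (ideal_gen (@TLrel n)).
Implicit Types (a b : F) (x y z : TL n) (c : {poly int}).

Lemma TLpi_eq a b : TLpi a = TLpi b <-> I (a - b).
Proof.
split=> [/eqP|H].
  by rewrite !TLpi.unlock -Quotient.idealrBE => /TLidealP.
by apply/eqP; rewrite !TLpi.unlock -Quotient.idealrBE; apply/TLidealP.
Qed.

Lemma TLpiK x : TLpi (repr x) = x. Proof. by rewrite TLpi.unlock reprK. Qed.

Lemma TLpiD a b : TLpi (a + b) = TLpi a + TLpi b.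
Proof. by rewrite !TLpi.unlock; exact: Quotient.pi_add. Qed.

Lemma IdealD a b : I a -> I b -> I (a + b).
Proof.
move=> Ha Hb; rewrite -[b]opprK; apply: IdealB => //.
by rewrite -sub0r; apply: IdealB => //; exact: Ideal0.
Qed.

Lemma IdealZ c a : I a -> I (c *: a).
Proof. by rewrite -mul_malgC; exact: IdealMl. Qed.

Lemma TLmul_pi a b : TLmul (TLpi a) (TLpi b) = TLpi (a * b).
Proof.
rewrite TLmul.unlock; apply/TLpi_eq; set a' := repr _; set b' := repr _.
have Ha : I (a' - a) by apply/TLpi_eq; rewrite TLpiK.
have Hb : I (b' - b) by apply/TLpi_eq; rewrite TLpiK.
have -> : a' * b' - a * b = (a' - a) * b' + a * (b' - b).
  by rewrite mulrBl mulrBr addrA subrK.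
by apply: IdealD; [exact: IdealMr | exact: IdealMl].
Qed.

Lemma TLscale_pi c a : TLscale c (TLpi a) = TLpi (c *: a).
Proof.
rewrite TLscale.unlock; apply/TLpi_eq; rewrite -scalerBr; apply: IdealZ.
by apply/TLpi_eq; rewrite TLpiK.
Qed.

Lemma TLind (P : TL n -> Prop) : (forall a, P (TLpi a)) -> forall x, P x.
Proof. by move=> H x; rewrite -[x]TLpiK; exact: H. Qed.

Fact TLmulA : associative (@TLmul n).
Proof.
by elim/TLind=> a; elim/TLind=> b; elim/TLind=> c; rewrite !TLmul_pi mulrA.
Qed.

Fact TLmul1x : left_id (TLone n) (@TLmul n).
Proof. by elim/TLind=> a; rewrite TLmul_pi mul1r. Qed.

Fact TLmulx1 : right_id (TLone n) (@TLmul n).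
Proof. by elim/TLind=> a; rewrite TLmul_pi mulr1. Qed.

Fact TLmulDl : left_distributive (@TLmul n) +%R.
Proof.
elim/TLind=> a; elim/TLind=> b; elim/TLind=> c.
by rewrite -TLpiD !TLmul_pi mulrDl TLpiD.
Qed.

Fact TLmulDr : right_distributive (@TLmul n) +%R.
Proof.
elim/TLind=> a; elim/TLind=> b; elim/TLind=> c.
by rewrite -TLpiD !TLmul_pi mulrDr TLpiD.
Qed.

(* The relations have no constant term, so the constant coefficient shows
   that 1 is not in the ideal. *)
Fact TLone_neq0 : TLone n != 0.
Proof.
have var0 i : (TLvar i : F)@_mone = 0.
  by rewrite TLvar.unlock mcoeffU fm1_eq1.
have cM a b : (a * b)@_mone = a@_mone * b@_mone := rmorphM (mcoeff mone) a b.
have cB a b : (a - b)@_mone = a@_mone - b@_mone by rewrite mcoeffB.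
have I0 a : I a -> a@_mone = 0.
  elim=> {a} [_ [i|i j _|i j _]||a b _ Ha _ Hb|a b _ Hb|a b _ Ha].
  - by rewrite cB mcoeffZ (cM (TLvar i)) (var0 i) !mulr0 subr0.
  - by rewrite cB (cM (_ * _)) (var0 i) mulr0 subr0.
  - exact: (rmorph_comm0 (mcoeff mone)).
  - exact: mcoeff0.
  - by rewrite cB Ha Hb subr0.
  - by rewrite cM Hb mulr0.
  - by rewrite cM Ha mul0r.
apply/eqP => E.
have E0 : (0 : TL n) = TLpi 0.
  by apply: (addrI (TLpi 0)); rewrite addr0 -TLpiD addr0.
have /TLpi_eq : TLpi (1 : F) = TLpi 0 by rewrite -E0 -E.
by rewrite subr0 => /I0 /eqP; rewrite mcoeff1 eqxx oner_eq0.
Qed.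

HB.instance Definition _ := GRing.Zmodule_isNzRing.Build (TL n)
  TLmulA TLmul1x TLmulx1 TLmulDl TLmulDr TLone_neq0.

Lemma TLpi1 : TLpi (1 : F) = 1. Proof. by []. Qed.

Lemma TLpiM a b : TLpi (a * b) = TLpi a * TLpi b.
Proof. by rewrite -TLmul_pi. Qed.

Fact TLscaleA c d x : TLscale c (TLscale d x) = TLscale (c * d) x.
Proof. by elim/TLind: x => a; rewrite !TLscale_pi scalerA. Qed.

Fact TLscale1 : left_id 1 (@TLscale n).
Proof. by elim/TLind=> a; rewrite TLscale_pi scale1r. Qed.

Fact TLscaleDr : right_distributive (@TLscale n) +%R.
Proof.
move=> c; elim/TLind=> a; elim/TLind=> b.
by rewrite -TLpiD !TLscale_pi scalerDr TLpiD.
Qed.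

Fact TLscaleDl x : {morph (@TLscale n)^~ x : c d / c + d}.
Proof.
by move=> c d; elim/TLind: x => a; rewrite !TLscale_pi scalerDl TLpiD.
Qed.

HB.instance Definition _ := GRing.Zmodule_isLmodule.Build {poly int} (TL n)
  TLscaleA TLscale1 TLscaleDr TLscaleDl.

Lemma TLpiZ c a : TLpi (c *: a) = c *: TLpi a.
Proof. by rewrite -TLscale_pi. Qed.

Fact TLscalerAl c x y : c *: (x * y) = (c *: x) * y.
Proof.
elim/TLind: x => a; elim/TLind: y => b.
by rewrite -TLpiZ -!TLpiM -TLpiZ scalerAl.
Qed.

Fact TLscalerAr c x y : c *: (x * y) = x * (c *: y).
Proof.
elim/TLind: x => a; elim/TLind: y => b.
by rewrite -TLpiZ -!TLpiM -TLpiZ malg_scalerAr.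
Qed.

HB.instance Definition _ :=
  GRing.Lmodule_isLalgebra.Build {poly int} (TL n) TLscalerAl.
HB.instance Definition _ :=
  GRing.Lalgebra_isAlgebra.Build {poly int} (TL n) TLscalerAr.

Fact TLpi_is_linear : linear (@TLpi n).
Proof. by move=> c a b; rewrite TLpiD TLpiZ. Qed.
HB.instance Definition _ :=
  GRing.isLinear.Build {poly int} F (TL n) _ (@TLpi n) TLpi_is_linear.
Fact TLpi_is_monoid_morphism : monoid_morphism (@TLpi n).
Proof. by split; [exact: TLpi1 | exact: TLpiM]. Qed.
HB.instance Definition _ :=
  GRing.isMonoidMorphism.Build F (TL n) (@TLpi n) TLpi_is_monoid_morphism.

End Structure.

(* Junk value 0 outside 0 < i < n. *)
HB.lock Definition TLe (n i : nat) : TL n :=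
  if insub i is Some j then TLpi (TLvar (j : TLidx n)) else 0.

Section Relations.
Variable n : nat.
Local Notation e := (TLe n).
Implicit Types (i j : nat).

Lemma TLeE i (Hi : (0 < i < n)%N) : e i = TLpi (TLvar (exist _ i Hi)).
Proof.
rewrite TLe.unlock; case: insubP => [u _ Eu|]; last by rewrite Hi.
by congr (TLpi (TLvar _)); apply: val_inj.
Qed.

Lemma TLe_out i : ~~ (0 < i < n)%N -> e i = 0.
Proof. by rewrite TLe.unlock; case: insubP => // u ->. Qed.

Lemma TLe_val (j : TLidx n) : e (val j) = TLpi (TLvar j).
Proof. by rewrite TLe.unlock valK. Qed.

Lemma TLe_sq i : (0 < i < n)%N -> e i * e i = 'X *: e i.
Proof.
move=> Hi; rewrite (TLeE Hi) -TLpiM -TLpiZ; apply/TLpi_eq/IdealGen.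
exact: TLrel_sq.
Qed.

Lemma TLe_adj i j : (0 < i < n)%N -> (0 < j < n)%N ->
  j = i.+1 \/ i = j.+1 -> e i * e j * e i = e i.
Proof.
move=> Hi Hj Hij; rewrite (TLeE Hi) (TLeE Hj) -!TLpiM.
by apply/TLpi_eq/IdealGen; exact: TLrel_adj.
Qed.

Lemma TLe_far i j : (i.+2 <= j)%N \/ (j.+2 <= i)%N -> e i * e j = e j * e i.
Proof.
move=> Hij.
have [Hi|/TLe_out ->] := boolP (0 < i < n)%N; last by rewrite mul0r mulr0.
have [Hj|/TLe_out ->] := boolP (0 < j < n)%N; last by rewrite mul0r mulr0.
rewrite (TLeE Hi) (TLeE Hj) -!TLpiM.
by apply/TLpi_eq/IdealGen; exact: TLrel_far.
Qed.

End Relations.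

(* The subalgebra generated by e_1, ..., e_(i-1) inside the n-th algebra. *)
Definition TLsub (n i : nat) : TL n -> Prop :=
  subalg_gen (fun a => exists2 j, (0 < j < i)%N & a = TLe n j).
Arguments TLsub : clear implicits.

Lemma TLsub_full n (x : TL n) : TLsub n n x.
Proof.
elim/TLind: x => a; elim/malg_ind: a => [|a b Ha Hb|c [s]].
- have -> : TLpi (0 : TLfree n) = 0 *: 1 by rewrite -TLpi1 -TLpiZ scale0r.
  by apply: SubalgZ; exact: Subalg1.
- by rewrite TLpiD; exact: SubalgD.
have -> : TLpi (<< c *g FMonom s >> : TLfree n) = c *: TLpi << FMonom s >>.
  rewrite -TLpiZ; congr TLpi; rewrite -mul_malgC malgUM mulr1.
  by congr << _ *g _ >>; apply: val_inj; rewrite /= fmM fm1.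
apply: SubalgZ; elim: s => [|j s IHs].
  have -> : FMonom [::] = mone :> {fmonom (TLidx n)}.
    by apply: val_inj; rewrite /= fm1.
  exact: Subalg1.
have -> : << FMonom (j :: s) >> = TLvar j * << FMonom s >> :> TLfree n.
  rewrite TLvar.unlock malgUM mulr1.
  by congr << _ *g _ >>; apply: val_inj; rewrite /= fmM fmU.
rewrite TLpiM; apply: SubalgM IHs; apply: SubalgGen.
by exists (val j); [exact: (valP j) | rewrite TLe_val].
Qed.

Section Anti.
Variables (A : nzRingType) (f : A -> A).
Hypotheses (fB : {morph f : a b / a - b}) (fD : {morph f : a b / a + b}).
Local Notation anti a b := (f (a * b) = f b * f a).

Lemma anti_addl a a' b : anti a b -> anti a' b -> anti (a + a') b.
Proof. by move=> H H'; rewrite mulrDl !fD H H' mulrDr. Qed.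

Lemma anti_addr a b b' : anti a b -> anti a b' -> anti a (b + b').
Proof. by move=> H H'; rewrite mulrDr !fD H H' mulrDl. Qed.

Lemma anti_invol_add a b :
  f (f a) = a -> f (f b) = b -> f (f (a + b)) = a + b.
Proof. by move=> Ea Eb; rewrite !fD Ea Eb. Qed.

Hypothesis fM : forall a b, anti a b.

Lemma anti_adj a b : f a = a -> f b = b ->
  f (a * b * a - a) = a * b * a - a.
Proof. by move=> Ea Eb; rewrite fB !fM Ea Eb mulrA. Qed.

Lemma anti_far a b : f a = a -> f b = b ->
  f (a * b - b * a) = b * a - a * b.
Proof. by move=> Ea Eb; rewrite fB !fM Ea Eb. Qed.
End Anti.

(* Reversal of words, extended linearly. *)
HB.lock Definition TLfree_rev n (a : TLfree n) : TLfree n :=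
  mmap (@malgC _ _)
    (fun m : {fmonom (TLidx n)} => << FMonom (rev (m : seq _)) >>) a.

HB.lock Definition TLstar n (x : TL n) : TL n := TLpi (TLfree_rev (repr x)).

Section Star.
Variable n : nat.
Local Notation F := (TLfree n).
Local Notation rev_ := (@TLfree_rev n).
Implicit Types (a b : F) (x y : TL n) (c : {poly int}).

Lemma TLfree_revU c m :
  rev_ << c *g m >> = << c *g FMonom (rev (m : seq _)) >>.
Proof. by rewrite TLfree_rev.unlock mmapU malgUM mulr1 mul1m. Qed.

Lemma TLfree_revB : {morph rev_ : a b / a - b}.
Proof. by move=> a b; rewrite TLfree_rev.unlock; exact: mmapB. Qed.

Lemma TLfree_revD : {morph rev_ : a b / a + b}.
Proof. by move=> a b; rewrite TLfree_rev.unlock; exact: mmapD. Qed.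

Lemma TLfree_rev0 : rev_ 0 = 0.
Proof. by rewrite TLfree_rev.unlock; exact: mmap0. Qed.

Lemma TLfree_revM a b : rev_ (a * b) = rev_ b * rev_ a.
Proof.
elim/malg_ind: a => [|a a' Ha Ha'|c k].
- by rewrite mul0r TLfree_rev0 mulr0.
- exact: (anti_addl TLfree_revD Ha Ha').
elim/malg_ind: b => [|b b' Hb Hb'|d l].
- by rewrite mulr0 TLfree_rev0 mul0r.
- exact: (anti_addr TLfree_revD Hb Hb').
rewrite malgUM 3!TLfree_revU malgUM mulrC; congr << _ *g _ >>.
by apply: val_inj; rewrite /= !fmM rev_cat.
Qed.

Lemma TLfree_revC c : rev_ c%:MP = c%:MP.
Proof.
by rewrite TLfree_revU; congr << _ *g _ >>; apply: val_inj; rewrite /= fm1.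
Qed.

Lemma TLfree_revZ c a : rev_ (c *: a) = c *: rev_ a.
Proof. by rewrite -!mul_malgC TLfree_revM TLfree_revC malgC_comm. Qed.

Lemma TLfree_rev_var (i : TLidx n) : rev_ (TLvar i) = TLvar i.
Proof.
rewrite TLvar.unlock TLfree_revU; congr << _ *g _ >>.
by apply: val_inj; rewrite /= fmU.
Qed.

Lemma TLfree_rev_ideal a :
  ideal_gen (@TLrel n) a -> ideal_gen (@TLrel n) (rev_ a).
Proof.
elim=> {a} [_ [i|i j Hij|i j Hij]||a b _ Ha _ Hb|a b _ Hb|a b _ Ha].
- rewrite TLfree_revB TLfree_revZ TLfree_revM TLfree_rev_var.
  by apply: IdealGen; exact: TLrel_sq.
- rewrite (anti_adj TLfree_revB TLfree_revM (TLfree_rev_var i) (TLfree_rev_var j)).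
  by apply: IdealGen; exact: TLrel_adj.
- rewrite (anti_far TLfree_revB TLfree_revM (TLfree_rev_var i) (TLfree_rev_var j)).
  by apply: IdealGen; apply: TLrel_far; case: Hij; [right | left].
- by rewrite TLfree_rev0; exact: Ideal0.
- by rewrite TLfree_revB; exact: IdealB.
- by rewrite TLfree_revM; exact: IdealMr.
- by rewrite TLfree_revM; exact: IdealMl.
Qed.

Lemma TLstar_pi a : TLstar (TLpi a) = TLpi (rev_ a).
Proof.
rewrite TLstar.unlock; apply/TLpi_eq; rewrite -TLfree_revB.
by apply: TLfree_rev_ideal; apply/TLpi_eq; rewrite TLpiK.
Qed.

Fact TLstar_is_linear : linear (@TLstar n).
Proof.
move=> c; elim/TLind=> a; elim/TLind=> b.
rewrite -TLpiZ -TLpiD; apply: etrans (TLstar_pi _) _.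
by rewrite TLfree_revD TLfree_revZ TLpiD TLpiZ !TLstar_pi.
Qed.
HB.instance Definition _ :=
  GRing.isLinear.Build {poly int} (TL n) (TL n) _ (@TLstar n) TLstar_is_linear.

Lemma TLstarM x y : TLstar (x * y) = TLstar y * TLstar x.
Proof.
elim/TLind: x => a; elim/TLind: y => b.
by rewrite -TLpiM !TLstar_pi TLfree_revM TLpiM.
Qed.

Lemma TLstar1 : TLstar (1 : TL n) = 1.
Proof. by rewrite -TLpi1 TLstar_pi (TLfree_revC 1). Qed.

Lemma TLstar_e i : TLstar (TLe n i) = TLe n i.
Proof.
rewrite TLe.unlock; case: insubP => [u _ _|_]; last exact: linear0.
by rewrite TLstar_pi TLfree_rev_var.
Qed.

Lemma TLstarK : involutive (@TLstar n).
Proof.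
elim/TLind=> a; rewrite 2!TLstar_pi; congr TLpi.
elim/malg_ind: a => [|a b Ha Hb|c k]; first by rewrite 2!TLfree_rev0.
  exact: (anti_invol_add TLfree_revD).
by rewrite 2!TLfree_revU; congr << _ *g _ >>; apply: val_inj; rewrite /= revK.
Qed.

End Star.

Definition z_from n (T : nat -> TL n) (i : nat) : TL n :=
  if (i < 2)%N then 0 else \sum_(k < i.+1) 'X ^+ k *: T (i - k)%N.

Definition T_step n (T : nat -> TL n) (i : nat) : TL n :=
  let e := TLe n in
  - (e i * T i) - T i * e i + e i * e i.-1 * T i * e i
  - z_from T i.-1 - e i * z_from T i.-2.

(* T_(i+1) depends on every earlier T_j through z, hence the list T_0, ..., T_m. *)
Fixpoint T_list n (m : nat) : seq (TL n) :=
  if m is i.+1 then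
    rcons (T_list n i)
      (match i with
       | 0 => 0
       | 1 => TLe n 1
       | _ => T_step (nth 0 (T_list n i)) i
       end)
  else [:: 0].

HB.lock Definition TLT n (i : nat) : TL n := nth 0 (T_list n i) i.
HB.lock Definition TLz n (i : nat) : TL n := z_from (TLT n) i.

Section TZ.
Variable n : nat.
Local Notation e := (TLe n).
Local Notation T_list := (T_list n).
Local Notation TLT := (TLT n).
Local Notation TLz := (TLz n).

Lemma size_T_list m : size (T_list m) = m.+1.
Proof. by elim: m => // m IH; rewrite /= size_rcons IH. Qed.

Lemma TLT_nth i : TLT i = nth 0 (T_list i) i.
Proof. by rewrite TLT.unlock. Qed.

Lemma nth_T_list m i : (i <= m)%N -> nth 0 (T_list m) i = TLT i.
Proof.
rewrite TLT_nth; elim: m => [|m IH]; first by rewrite leqn0 => /eqP->.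
rewrite leq_eqVlt => /predU1P[-> //|lt_im].
by rewrite [T_list m.+1]/= nth_rcons size_T_list lt_im IH.
Qed.

Lemma TLT0 : TLT 0 = 0. Proof. by rewrite TLT_nth. Qed.
Lemma TLT1 : TLT 1 = 0. Proof. by rewrite TLT_nth. Qed.
Lemma TLT2 : TLT 2 = e 1. Proof. by rewrite TLT_nth. Qed.

Lemma TLz0 : TLz 0 = 0. Proof. by rewrite TLz.unlock. Qed.
Lemma TLz1 : TLz 1 = 0. Proof. by rewrite TLz.unlock. Qed.
Lemma TLzE i : (2 <= i)%N -> TLz i = \sum_(k < i.+1) 'X ^+ k *: TLT (i - k)%N.
Proof. by rewrite TLz.unlock /z_from leqNgt => /negbTE ->. Qed.

Lemma TLT_rec i : (2 <= i)%N ->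
  TLT i.+1 = - (e i * TLT i) - TLT i * e i + e i * e i.-1 * TLT i * e i
             - TLz i.-1 - e i * TLz i.-2.
Proof.
move=> i2; rewrite [LHS]TLT_nth.
have -> : T_list i.+1 = rcons (T_list i) (T_step (nth 0 (T_list i)) i).
  by case: i i2 => [|[|i]].
rewrite nth_rcons size_T_list ltnn eqxx.
have zE m : (m <= i)%N -> z_from (nth 0 (T_list i)) m = TLz m.
  move=> mi; rewrite TLz.unlock /z_from; case: (m < 2)%N; first by [].
  apply: eq_bigr => k _; congr (_ *: _); apply: nth_T_list.
  exact: leq_trans (leq_subr _ _) mi.
have i1 : (i.-1 <= i)%N := leq_pred i.
have i2' : (i.-2 <= i)%N := leq_trans (leq_pred _) i1.
by rewrite /T_step (zE _ i1) (zE _ i2') (nth_T_list (leqnn i)).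
Qed.

End TZ.

(* Main.v *)
Require Import Defs.
From mathcomp Require Import all_boot all_order all_algebra.
From mathcomp Require Import ring zify.

Import GRing.Theory.
Local Open Scope ring_scope.
Set Implicit Arguments.
Unset Strict Implicit.

(* With T_i = z_i - x z_(i-1), everything follows from the centrality of z_i in
   A_i.  In terms of z alone the recurrence reads
     z_(i+1) = x z_i - e_i z_i - z_i e_i + x e_i z_(i-1) + e_i e_(i-1) z_i e_i
               - z_(i-1) - e_i z_(i-2),
   and centrality is proved by induction on i.  The element z_(i+1) commutes with
   e_i by a direct computation, with e_(i-1) after expanding z_i, and with e_(i-2)
   after expanding z_i and z_(i-1), which reduces the claim to elements of the form
   e_i e_(i-1) e_(i-2) u e_(i-2) e_(i-1) e_i, where u commutes with e_i.  The
   e_j with j < i-2 commute with every term. *)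

(** * Reflection of linear identities in a module *)

Inductive lexpr (R : Type) :=
| LAtom of nat
| LAdd of lexpr R & lexpr R
| LOpp of lexpr R
| LScale of R & lexpr R.

Section LinearReflection.
Variables (R : comNzRingType) (V : lmodType R).
Implicit Types (env : seq V) (t : lexpr R).

Fixpoint leval env t : V :=
  match t with
  | LAtom i => nth 0 env i
  | LAdd t1 t2 => leval env t1 + leval env t2
  | LOpp t1 => - leval env t1
  | LScale k t1 => k *: leval env t1
  end.

Fixpoint lcoef t (i : nat) : R :=
  match t with
  | LAtom j => if eqn i j then 1 else 0
  | LAdd t1 t2 => lcoef t1 i + lcoef t2 i
  | LOpp t1 => - lcoef t1 i
  | LScale k t1 => k * lcoef t1 i
  end.

Lemma leval_lcoef env t :
  leval env t = \sum_(i < size env) lcoef t i *: env`_i.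
Proof.
elim: t => [j|t1 IH1 t2 IH2|t1 IH1|k t1 IH1] /=.
- have [lt_j|ge_j] := ltnP j (size env).
    rewrite (bigD1 (Ordinal lt_j)) //= -[eqn j j]/(j == j) eqxx scale1r.
    rewrite big1 ?addr0 // => i.
    by rewrite -val_eqE -[eqn i j]/(val i == j) => /negbTE ->; rewrite scale0r.
  rewrite nth_default // big1 // => i _; rewrite -[eqn i j]/(val i == j).
  by rewrite ltn_eqF ?scale0r // (leq_trans (ltn_ord i)).
- by rewrite IH1 IH2 -big_split; apply: eq_bigr => i _; rewrite scalerDl.
- by rewrite IH1 -sumrN; apply: eq_bigr => i _; rewrite scaleNr.
- by rewrite IH1 scaler_sumr; apply: eq_bigr => i _; rewrite scalerA.
Qed.

(** A recursive conjunction, which [cbn] unfolds into one coefficient identity per atom, each a goal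
    for [ring]. *)
Fixpoint lcoef_eq t1 t2 (n : nat) : Prop :=
  if n is m.+1 then lcoef t1 m = lcoef t2 m /\ lcoef_eq t1 t2 m else True.

Lemma leval_eq env t1 t2 :
  lcoef_eq t1 t2 (size env) -> leval env t1 = leval env t2.
Proof.
rewrite !leval_lcoef; elim: (size env) => [|m IH]; first by rewrite !big_ord0.
by case=> E /IH Em; rewrite !big_ord_recr /= Em E.
Qed.
End LinearReflection.

Ltac latom u env :=
  lazymatch env with
  | nil => constr:((0%N, [:: u]))
  | cons ?v ?env' =>
    (* up to conversion: equal atoms may come with different canonical instances *)
    match constr:(Set) with
    | _ => let _ := constr:(erefl u : u = v) in constr:((0%N, env))
    | _ => lazymatch latom u env' with
           | (?i, ?env'') => constr:((S i, cons v env''))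
           end
    end
  end.

Ltac lreify R t env :=
  lazymatch t with
  | ?u + ?v =>
    lazymatch lreify R u env with
    | (?e1, ?env1) =>
      lazymatch lreify R v env1 with
      | (?e2, ?env2) => constr:((LAdd e1 e2, env2))
      end
    end
  | - ?u =>
    lazymatch lreify R u env with
    | (?e1, ?env1) => constr:((LOpp e1, env1))
    end
  | ?k *: ?u =>
    lazymatch lreify R u env with
    | (?e1, ?env1) => constr:((LScale k e1, env1))
    end
  | ?u =>
    lazymatch latom u env with
    | (?i, ?env') => constr:((LAtom R i, env'))
    end
  end.

(* Proves an R-linear identity between atoms of a module by [ring] on the
   coefficients. *)
Ltac lmod_eq R :=
  lazymatch goal with
  | |- @eq ?V ?u ?v =>
    lazymatch lreify R u (@nil V) with
    | (?e1, ?env1) =>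
      lazymatch lreify R v env1 with
      | (?e2, ?env2) =>
        refine (@leval_eq R _ env2 e1 e2 _); cbn [size lcoef lcoef_eq eqn];
        repeat split; ring
      end
    end
  end.

(** * The recurrence for z in an arbitrary algebra *)

Section Zstep.
Variables (R : comNzRingType) (A : algType R) (x : R).
Implicit Types (a b c d u v w : A).

Lemma commrZ k u v : GRing.comm u v -> GRing.comm u (k *: v).
Proof. by rewrite /GRing.comm -scalerAr -scalerAl => ->. Qed.

(** In left-associated products a relation is met after a prefix [u]; [mulK2] and [mulK3] make it
    rewritable there. *)
Let mulK2 a b w : a * b = w -> forall u, u * a * b = u * w.
Proof. by move=> <- u; rewrite mulrA. Qed.

Let mulK3 a b c w : a * b * c = w -> forall u, u * a * b * c = u * w.
Proof. by move=> <- u; rewrite !mulrA. Qed.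

(** For [a], [b] = e_i, e_(i-1) and [w2], [w1], [w0] = z_i, z_(i-1), z_(i-2) this is z_(i+1). *)
Definition zstep a b w2 w1 w0 : A :=
  x *: w2 - (a * w2 + w2 * a) + x *: (a * w1) + a * b * w2 * a - w1 - a * w0.

Let algE := (@mulrDl A, @mulrDr A, @mulrBl A, @mulrBr A, @mulNr A, @mulrN A,
  @mulrA A, fun k u v => esym (@scalerAl R A k u v),
  fun k u v => esym (@scalerAr R A k u v)).

(** On either side [x *: w2 - (a * w2 + w2 * a)] contributes [- (a * w2 * a)]. *)
Lemma zstep_comm_top a b w2 w1 w0 : a * a = x *: a ->
  GRing.comm a w1 -> GRing.comm a w0 -> GRing.comm a (zstep a b w2 w1 w0).
Proof.
move=> aa /esym a1 /esym a0.
rewrite /GRing.comm /zstep.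
rewrite !(algE, aa, a1, a0, mulK2 aa, mulK2 a1, mulK2 a0).
lmod_eq R.
Qed.

(** [V] stands for T_i + z_(i-2). The two products with [b] are [x *: (w2 * b)] minus the two sides
    of the last hypothesis. *)
Lemma zstep_comm_next a b w2 w1 w0 (V := w2 - x *: w1 + w0) : b * a * b = b ->
  GRing.comm b w2 -> GRing.comm a w1 -> GRing.comm a w0 ->
  b * a * V + b * w1 = V * a * b + w1 * b ->
  GRing.comm b (zstep a b w2 w1 w0).
Proof.
move=> bab b2 a1 a0 EV; have b2' := esym b2.
rewrite /GRing.comm.
have -> : b * zstep a b w2 w1 w0 = x *: (w2 * b) - (b * a * V + b * w1).
  rewrite /V /zstep -b2 !(algE, bab, b2', mulK3 bab, mulK2 b2').
  lmod_eq R.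
have -> : zstep a b w2 w1 w0 * b = x *: (w2 * b) - (V * a * b + w1 * b).
  rewrite /V /zstep !(algE, bab, mulK3 bab, b2, mulK2 b2, a1, a0).
  lmod_eq R.
by rewrite EV.
Qed.

(** Supplies the last hypothesis of [zstep_comm_next] when its [w2] is itself a step. In [V] the
    terms [x *: w2] and [w1] cancel, and [b * a * b = b] collapses most of the rest. *)
Lemma zstep_next_cond a b c w2 w1 w0
    (w3 := zstep b c w2 w1 w0) (V := w3 - x *: w2 + w1) :
  b * a * b = b -> GRing.comm a w2 -> GRing.comm b w1 -> GRing.comm b w0 ->
  b * a * V + b * w2 = V * a * b + w2 * b.
Proof.
move=> bab a2 b1 b0.
have -> : b * a * V + b * w2 =
    - (b * w2 * a * b) + x *: (b * w1) + b * c * w2 * b - b * w0.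
  rewrite /V /w3 /zstep !(algE, bab, mulK3 bab, a2, mulK2 a2).
  lmod_eq R.
have -> : V * a * b + w2 * b =
    - (b * w2 * a * b) + x *: (w1 * b) + b * c * w2 * b - w0 * b.
  rewrite /V /w3 /zstep !(algE, bab, mulK3 bab, b1, b0, mulK2 b1, mulK2 b0).
  lmod_eq R.
by rewrite b1 b0.
Qed.

(** All other terms of [zstep] are built from [a], [w3] and [w2], so only two remain, to be treated
    jointly. *)
Lemma zstep_comm_lower a b c w3 w2 w1 :
  GRing.comm c a -> GRing.comm c w3 -> GRing.comm c w2 ->
  GRing.comm c (a * b * w3 * a - a * w1) ->
  GRing.comm c (zstep a b w3 w2 w1).
Proof.
move=> ca c3 c2 cW.
have -> : zstep a b w3 w2 w1 = x *: w3 - (a * w3 + w3 * a) + x *: (a * w2)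
    + (a * b * w3 * a - a * w1) - w2 by rewrite /zstep; lmod_eq R.
apply: commrB => //; apply: commrD => //; apply: commrD; last first.
  by apply: commrZ; apply: commrM.
apply: commrB; first exact: commrZ.
by apply: commrD; apply: commrM.
Qed.

(** Evaluates the two terms left by [zstep_comm_lower] when [w3] is itself a step. *)
Lemma zstep_sandwich a b c w2 w1 w0 :
  b * b = x *: b -> a * b * a = a ->
  GRing.comm a w1 -> GRing.comm a w0 ->
  a * b * zstep b c w2 w1 w0 * a - a * w1 =
  x *: (a * b * c * w2 * b * a) - a * b * w2 * b * a
  + (x * x - 2) *: (a * w1) - x *: (a * w0).
Proof.
move=> bb aba /esym a1 /esym a0.
rewrite /zstep.
rewrite !(algE, bb, mulK2 bb, aba, mulK3 aba, a1, a0, mulK2 a1, mulK2 a0).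
lmod_eq R.
Qed.

(** Both products with [c] collapse to [a * (c * u * c)]: [c * b * c = c] removes one [b], and
    [a * b * a = a] the other, because [a] commutes with [c * u * c]. *)
Lemma commr_nested a b c u : a * b * a = a -> c * b * c = c ->
  GRing.comm a c -> GRing.comm a u -> GRing.comm c (a * b * c * u * c * b * a).
Proof.
move=> aba cbc ac au.
have acuc : GRing.comm a (c * u * c) := commrM (commrM ac au) ac.
have aXa : a * (c * u * c) * b * a = c * u * c * a.
  by rewrite acuc -!mulrA (mulrA a b) aba !mulrA.
rewrite /GRing.comm [LHS](_ : _ = a * (c * b * c) * u * c * b * a); last first.
  by rewrite !mulrA ac.
rewrite [RHS](_ : _ = a * b * c * u * (c * b * c) * a); last first.
  by rewrite -![in LHS]mulrA ac !mulrA.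
rewrite cbc [LHS](_ : _ = a * (c * u * c) * b * a); last by rewrite !mulrA.
rewrite [RHS](_ : _ = a * b * (c * u * c * a)); last by rewrite !mulrA.
by rewrite aXa -acuc [RHS]mulrA aba.
Qed.

(** Here [a], [b], [c], [d] are e_i, ..., e_(i-3) and [w1], [w0], [y] are z_(i-2), z_(i-3), z_(i-4),
    so that [w2], [w3] are z_(i-1), z_i. *)
Lemma zstep_comm_second a b c d w1 w0 y
    (w2 := zstep c d w1 w0 y) (w3 := zstep b c w2 w1 w0) :
  b * b = x *: b -> c * c = x *: c ->
  a * b * a = a -> b * c * b = b -> c * b * c = c ->
  GRing.comm a c -> GRing.comm a d ->
  GRing.comm a w1 -> GRing.comm a w0 -> GRing.comm a y ->
  GRing.comm b w1 -> GRing.comm b w0 -> GRing.comm b y ->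
  GRing.comm c w0 -> GRing.comm c y -> GRing.comm c w2 -> GRing.comm c w3 ->
  GRing.comm c (zstep a b w3 w2 w1).
Proof.
move=> bb cc aba bcb cbc ac ad a1 a0 ay b1 b0 by_ c0 cy c2 c3.
have ca := commr_sym ac; apply: zstep_comm_lower => //.
rewrite zstep_sandwich //.
have -> : a * b * w2 * b * a = (x * x - 2) *: (a * w1) - a * y
    + a * b * c * d * w1 * c * b * a.
  have [b1' b0' by'] := And3 (esym b1) (esym b0) (esym by_).
  have [a1' ay'] := conj (esym a1) (esym ay).
  have bwcb u : u * b * w1 * c * b = u * b * w1.
    by rewrite -!mulrA (mulrA b) b1 -mulrA (mulrA b) bcb b1'.
  rewrite /w2 /zstep !(algE, bb, mulK2 bb, aba, mulK3 aba, bwcb, mulK3 bcb,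
    mulK2 b1', mulK2 b0', mulK2 by', mulK2 a1', mulK2 ay').
  lmod_eq R.
have -> : a * b * c * w2 * b * a = a * w0 + x *: (a * b * c * d * w1 * c * b * a)
    - a * b * c * w1 * c * b * a + (x * x - 2) *: (a * w0) - x *: (a * y).
  (* [b * w0] is subtracted and restored so that [zstep_sandwich] applies one index lower. *)
  transitivity (a * (b * c * w2 * b - b * w0 + b * w0) * a).
    by rewrite subrK !mulrA.
  have [a0' ay'] := conj (esym a0) (esym ay).
  rewrite zstep_sandwich //.
  rewrite !(algE, b0, by_, aba, mulK3 aba).
  have -> : a * w0 * b * a = a * w0.
    by rewrite a0 -!mulrA (mulrA a) aba.
  have -> : a * y * b * a = a * y.
    by rewrite ay -!mulrA (mulrA a) aba.
  lmod_eq R.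
have nest u : GRing.comm a u -> GRing.comm c (a * b * c * u * c * b * a).
  exact: commr_nested.
have nestd := nest _ (commrM ad a1); rewrite !mulrA in nestd.
have nest1 := nest _ a1.
have ca0 : GRing.comm c (a * w0) by apply: commrM.
have cay : GRing.comm c (a * y) by apply: commrM.
(* The multiples of [a * w1], where [c] need not commute with [w1], cancel; two nested products and
   two harmless terms are left. *)
rewrite [X in GRing.comm c X](_ : _ =
    (x * x - 1) *: (a * b * c * d * w1 * c * b * a)
    - x *: (a * b * c * w1 * c * b * a)
    + (x * x * x - 2 * x) *: (a * w0) + (1 - x * x) *: (a * y)); last first.
  by lmod_eq R.
by do ![apply: commrB | apply: commrD | apply: commrZ].
Qed.

(* The case i = 3, where z_2 = e_1 is not given by the recurrence. *)
Lemma zstep_comm_second3 a b c (w3 := zstep b c c 0 0) :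
  b * b = x *: b -> c * c = x *: c ->
  a * b * a = a -> b * c * b = b -> GRing.comm a c -> GRing.comm c w3 ->
  GRing.comm c (zstep a b w3 c 0).
Proof.
move=> bb cc aba bcb ac c3; have ca := commr_sym ac.
have a0 : GRing.comm a 0 := commr0 a.
apply: zstep_comm_lower => //; rewrite zstep_sandwich //.
have -> : a * b * c * c * b * a = x *: a.
  by rewrite -(mulrA (a * b)) cc -scalerAr -!scalerAl -(mulrA a) -(mulrA a) bcb aba.
rewrite -(mulrA a b c) -(mulrA a) bcb aba !mulr0 !scaler0 subr0 addr0.
by apply: commrB => //; do 2!apply: commrZ.
Qed.

End Zstep.

(** * Centrality and symmetry of z in the Temperley-Lieb algebra *)

Section TLz.
Variable n : nat.
Local Notation e := (TLe n).
Local Notation T := (TLT n).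
Local Notation z := (TLz n).
Local Notation x := ('X : {poly int}).

Lemma TLzS m : z m.+1 = T m.+1 + x *: z m.
Proof.
(* The sum formula covers i = 0, 1 as well, because T_0 = T_1 = 0. *)
have z_sum i : z i = \sum_(k < i.+1) x ^+ k *: T (i - k)%N.
  case: i => [|[|i]]; last exact: TLzE.
    by rewrite TLz0 big_ord1 subn0 TLT0 scaler0.
  by rewrite TLz1 2!big_ord_recr big_ord0 /= TLT0 TLT1 !scaler0 !addr0.
rewrite !z_sum big_ord_recl expr0 scale1r subn0; congr (_ + _).
by rewrite scaler_sumr; apply: eq_bigr => k _; rewrite scalerA -exprS.
Qed.

Lemma TLT_TLz m : T m.+1 = z m.+1 - x *: z m.
Proof. by rewrite TLzS addrK. Qed.

Lemma TLz2 : z 2 = e 1.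
Proof. by rewrite TLzS TLz1 scaler0 addr0 TLT2. Qed.

Lemma TLsubB i (u v : TL n) : TLsub n i u -> TLsub n i v -> TLsub n i (u - v).
Proof.
by move=> Hu Hv; apply: SubalgD => //; rewrite -scaleN1r; exact: SubalgZ.
Qed.

Lemma TLsub0 i : TLsub n i 0.
Proof. by rewrite -(scale0r 1); apply: SubalgZ; exact: Subalg1. Qed.

Lemma TLsubS i u : TLsub n i u -> TLsub n i.+1 u.
Proof.
elim=> {u} [u [j /andP[j0 ji] ->]||u v _ Hu _ Hv|k u _ Hu|u v _ Hu _ Hv].
- by apply: SubalgGen; exists j; rewrite // j0 ltnW.
- exact: Subalg1.
- exact: SubalgD.
- exact: SubalgZ.
- exact: SubalgM.
Qed.

Lemma TLsub_comm i (v : TL n) :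
  (forall j, (0 < j < i)%N -> GRing.comm v (e j)) ->
  commutes_with (TLsub n i) v.
Proof.
move=> H u; elim=> {u} [u [j ji ->]||u u' _ Hu _ Hu'|k u _ Hu|u u' _ Hu _ Hu'].
- exact: H.
- exact: commr1.
- exact: commrD.
- exact: commrZ.
- exact: commrM.
Qed.

Lemma TLsub_e i j : (0 < j < i)%N -> TLsub n i (e j).
Proof. by move=> ji; apply: SubalgGen; exists j. Qed.

Lemma TLT_TLz_sub m : TLsub n m (T m) /\ TLsub n m (z m).
Proof.
elim/ltn_ind: m => m IH.
have subT : TLsub n m (T m).
  case: m IH => [|[|[|m]]] IH.
  - by rewrite TLT0; exact: TLsub0.
  - by rewrite TLT1; exact: TLsub0.
  - by rewrite TLT2; exact: TLsub_e.
  rewrite TLT_rec //=.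
  have e2 : TLsub n m.+3 (e m.+2) by apply: TLsub_e; rewrite !ltnS leqnn.
  have e1 : TLsub n m.+3 (e m.+1) by apply: TLsub_e; rewrite !ltnS leqnSn.
  have T2 : TLsub n m.+3 (T m.+2) by apply: TLsubS; case: (IH m.+2).
  have z1 : TLsub n m.+3 (z m.+1) by do 2!apply: TLsubS; case: (IH m.+1).
  have z0 : TLsub n m.+3 (z m) by do 3!apply: TLsubS; case: (IH m); rewrite // ltnW.
  rewrite -[- (_ * _)]scaleN1r.
  by do ![apply: TLsubB | apply: SubalgD | apply: SubalgZ | apply: SubalgM].
split=> //; case: m IH subT => [|m] IH subT; first by rewrite TLz0; exact: TLsub0.
rewrite TLzS; apply: SubalgD => //; apply: SubalgZ; apply: TLsubS.
by case: (IH m).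
Qed.

(** [z m] is built from the e_k with k < m, so that k + 2 <= j. *)
Lemma TLz_far m j : (m < j)%N -> GRing.comm (e j) (z m).
Proof.
move=> lt_mj; have [_ Hz] := TLT_TLz_sub m.
apply: (TLsub_comm _ Hz) => k /andP[_ lt_km]; apply: TLe_far; right.
exact: leq_ltn_trans lt_mj.
Qed.

(** Substitute T_(m+2) = z_(m+2) - x z_(m+1). As e_(m+2) commutes with z_(m+1), the new terms are
    multiples of e_(m+2) z_(m+1), with total coefficient 2x - x = x. *)
Lemma TLz_step m : (m.+2 < n)%N ->
  z m.+3 = zstep x (e m.+2) (e m.+1) (z m.+2) (z m.+1) (z m).
Proof.
move=> lt_mn; have lt_mn' : (m.+1 < n)%N := ltnW lt_mn.
have aba : e m.+2 * e m.+1 * e m.+2 = e m.+2 by apply: TLe_adj => //; right.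
have a1 : GRing.comm (e m.+2) (z m.+1) by exact: TLz_far.
rewrite TLzS TLT_rec //= TLT_TLz /zstep !(mulrBl, mulrBr) -!(scalerAl, scalerAr).
have -> : z m.+1 * e m.+2 = e m.+2 * z m.+1 by rewrite a1.
have -> : e m.+2 * e m.+1 * z m.+1 * e m.+2 = e m.+2 * z m.+1.
  by rewrite -mulrA -a1 mulrA aba.
lmod_eq {poly int}.
Qed.

Lemma TLz_comm m j : (m <= n)%N -> (0 < j < m)%N -> GRing.comm (e j) (z m).
Proof.
elim/ltn_ind: m j => m IH j; case: m IH => [|[|[|k]]] IH le_mn.
- by rewrite ltn0 andbF.
- by case: j => [|[|]] //; rewrite andbF.
- by case: j => [|[|[|j]]] // _; rewrite TLz2.
case/andP=> j0; rewrite ltnS => le_jk.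
have sq i : (0 < i <= k.+2)%N -> e i * e i = x *: e i.
  by move=> /andP[i0 ik]; apply: TLe_sq; rewrite i0 (leq_trans _ le_mn).
have adj i : (0 < i <= k.+1)%N ->
    e i * e i.+1 * e i = e i /\ e i.+1 * e i * e i.+1 = e i.+1.
  move=> /andP[i0 ik].
  have i1n : (i.+1 < n)%N by apply: leq_trans le_mn.
  by split; apply: TLe_adj; rewrite ?i0 ?(ltnW i1n) //; [left|right].
rewrite TLz_step //.
(* The top generator, j = k + 2. *)
move: le_jk; rewrite leq_eqVlt => /predU1P[->|].
  by apply: zstep_comm_top; rewrite ?sq ?leqnn //; apply: TLz_far.
(* The next generator, j = k + 1. *)
rewrite ltnS leq_eqVlt => /predU1P[->|].
  have bab : e k.+1 * e k.+2 * e k.+1 = e k.+1 by apply: (proj1 (adj _ _)); exact: leqnn.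
  apply: zstep_comm_next => //; try exact: TLz_far.
    by apply: IH; rewrite ?leqnn //; exact: ltnW.
  (* For k = 0, z_2 = e_1 is not a step, but [V] is e_1 and both sides are e_1 e_2 e_1. *)
  case: k IH le_mn sq adj bab => [|k] IH le_mn _ _ bab.
    rewrite TLz2 TLz1 TLz0 scaler0 subr0 addr0 mulr0 mul0r !addr0.
    by rewrite -[RHS]mulrA mulrA.
  rewrite (TLz_step (ltnW le_mn)).
  by apply: zstep_next_cond => //; exact: TLz_far.
(* The case j = k: z_(k+2) and z_(k+1) are both expanded, except that for k = 1 the latter is z_2 =
   e_1. *)
rewrite ltnS leq_eqVlt => /predU1P[Ejk|lt_jk].
  case: k Ejk IH le_mn sq adj => [|k] Ejk IH le_mn sq adj; first by rewrite Ejk in j0.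
  have c3 : GRing.comm (e j) (z k.+3) by apply: IH; lia.
  move: c3; rewrite Ejk in j0 *; rewrite (TLz_step (ltnW le_mn)).
  have ac : GRing.comm (e k.+3) (e k.+1) by apply: TLe_far; right.
  have [cbc bcb] := adj k.+1 (leqnSn _).
  have aba : e k.+3 * e k.+2 * e k.+3 = e k.+3 by case: (adj k.+2 (leqnn _)).
  have bb := sq k.+2 (leqnSn _).
  case: k {Ejk j0 adj} IH le_mn sq ac bcb cbc aba bb
    => [|k] IH le_mn sq ac bcb cbc aba bb.
    rewrite TLz2 TLz1 TLz0; apply: zstep_comm_second3 => //.
    exact: sq.
  have c2 : GRing.comm (e k.+2) (z k.+3).
    by apply: IH; [|exact: ltnW (ltnW le_mn)|rewrite /= leqnn].
  move: c2; rewrite (TLz_step (ltnW (ltnW le_mn))) => c2 c3.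
  apply: zstep_comm_second => //;
    by [apply: TLz_far; lia | apply: TLe_far; right; lia | apply: sq; lia].
(* For j < k, e_j commutes with every factor of the recurrence. *)
have ja : GRing.comm (e j) (e k.+2) by apply: TLe_far; left; rewrite !ltnS ltnW.
have jb : GRing.comm (e j) (e k.+1) by apply: TLe_far; left; rewrite ltnS.
have j2 : GRing.comm (e j) (z k.+2) by apply: IH; lia.
have j1 : GRing.comm (e j) (z k.+1) by apply: IH; lia.
have j0' : GRing.comm (e j) (z k) by apply: IH; lia.
apply: zstep_comm_lower => //; apply: commrB; last exact: commrM.
by do 3?apply: commrM.
Qed.

(** [TLstar] reverses the products in the recurrence; [TLz_comm] and [TLz_far] restore their
    order. *)
Lemma TLstar_z m : (m <= n)%N -> TLstar (z m) = z m.
Proof.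
elim/ltn_ind: m => -[|[|[|k]]] IH le_mn.
- by rewrite TLz0 linear0.
- by rewrite TLz1 linear0.
- by rewrite TLz2 TLstar_e.
rewrite TLz_step // /zstep !(linearB, linearD, linearZ) /=.
rewrite !TLstarM !TLstar_e !IH //; try lia.
have -> : z k.+1 * e k.+2 = e k.+2 * z k.+1 by rewrite (TLz_far (leqnn _)).
have -> : z k * e k.+2 = e k.+2 * z k by rewrite (@TLz_far k) // ltnW.
have bz : e k.+1 * z k.+2 = z k.+2 * e k.+1 by apply: TLz_comm; lia.
have -> : e k.+2 * e k.+1 * z k.+2 * e k.+2 = e k.+2 * (z k.+2 * (e k.+1 * e k.+2)).
  by rewrite -(mulrA (e k.+2)) bz !mulrA.
lmod_eq {poly int}.
Qed.

(** Both terms of T_(m+1) = z_(m+1) - x z_m commute with e_j. This gives (4) and (6). *)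
Lemma TLT_comm m j : (m < n)%N -> (0 < j < m)%N -> GRing.comm (T m.+1) (e j).
Proof.
move=> lt_mn lt_jm; rewrite TLT_TLz; apply: commr_sym.
by apply: commrB; [|apply: commrZ]; apply: TLz_comm; lia.
Qed.

End TLz.

Theorem lemma3p1 (n i : nat) (hi : (2 <= i)%N) :
  let e := TLe n in
  let T := TLT n in
  let z := TLz n in
  let A := TLsub n in
  let x : {poly int} := 'X in
  [/\ (* 1 *) (i.+1 < n)%N ->
        e i.+1 * e i * T i * e i.+1 = e i.+1 * T i * e i * e i.+1,
      (* 2 *) (i < n)%N ->
        e i * e i.-1 * T i * e i = e i * T i * e i.-1 * e i,
      (* 3 *) (i <= n)%N ->
        TLstar (z i) = z i /\ TLstar (T i) = T i,
      (* 4 *) (i < n)%N ->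
        e i.-1 * T i.+1 = T i.+1 * e i.-1 &
  [/\ (* 5 *) (i < n)%N ->
        e i * (x *: T i + T i.+1) = (x *: T i + T i.+1) * e i,
      (* 6 *) (i <= n)%N -> commutes_with (A i.-1) (T i) &
      (* 7 *) (i <= n)%N -> central_in (A i) (z i)]].
Proof.
case: i hi => [|[|m]] // _ e T z A x.
have Tfar : GRing.comm (e m.+3) (T m.+2).
  by rewrite /T TLT_TLz; apply: commrB; [|apply: commrZ]; apply: TLz_far.
split; last split.
(* Both sides collapse to T_i e_(i+1), where i = m + 2. *)
- move=> lt_mn.
  have aba : e m.+3 * e m.+2 * e m.+3 = e m.+3 by apply: TLe_adj; lia.
  by rewrite -(mulrA _ (T _)) -Tfar !mulrA aba Tfar -!mulrA (mulrA (e _)) aba.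
- move=> lt_mn /=.
  have aba : e m.+2 * e m.+1 * e m.+2 = e m.+2 by apply: TLe_adj; lia.
  have bz : e m.+1 * z m.+2 = z m.+2 * e m.+1 by apply: TLz_comm; lia.
  have az : e m.+2 * z m.+1 = z m.+1 * e m.+2 by exact: TLz_far.
  (* In T_i = z_i - x z_(i-1), the first term commutes with e_(i-1); the second commutes with e_i,
     so both of its products collapse. *)
  rewrite /T TLT_TLz !(mulrBl, mulrBr) -!(scalerAl, scalerAr).
  congr (_ - _ *: _); first by rewrite -(mulrA (e _)) bz mulrA.
  rewrite -[LHS]mulrA -az mulrA aba az.
  by rewrite -!mulrA (mulrA (e m.+2)) aba.
- move=> le_mn; rewrite /z /T TLT_TLz linearB linearZ /=.
  by rewrite !TLstar_z // ltnW.
- by move=> lt_mn; symmetry; apply: TLT_comm; lia.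
(* In x T_i + T_(i+1) the multiples of z_i cancel, leaving z_(i+1) and z_(i-1), which commute with
   e_i. *)
- move=> lt_mn; rewrite [X in _ * X](_ : _ = z m.+3 - (x * x) *: z m.+1); last first.
    by rewrite /T /x !TLT_TLz; lmod_eq {poly int}.
  rewrite [in RHS](_ : _ + _ = z m.+3 - (x * x) *: z m.+1); last first.
    by rewrite /T /x !TLT_TLz; lmod_eq {poly int}.
  by apply: commrB; [apply: TLz_comm; lia|apply: commrZ; exact: TLz_far].
- by move=> le_mn; apply: TLsub_comm => j lt_jm; apply: TLT_comm.
move=> le_mn; split; first by have [] := TLT_TLz_sub n m.+2.
apply: TLsub_comm => j lt_jm; apply: commr_sym; exact: TLz_comm.
Qed.
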